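(* Let $T=3$ and suppose $\overline{V}\ge\underline{C}+V$, $\overline{C}-\underline{C}-V\ge0$ and $\overline{C}-\overline{V}-V<0$. Let $(\mathrm{F1})$ and $(\mathrm{F2})$ denote the inequalities \begin{align*} (\mathrm{F1})\quad & x_3-x_1\le(\underline{C}+2V)y_3-\underline{C}y_1-(\underline{C}+2V-\overline{V})u_3+(\overline{C}-\underline{C}-2V)u_2,\\ (\mathrm{F2})\quad & x_1-x_3\le\overline{V}y_1+(\overline{C}-\overline{V})y_2-(\overline{C}-2V)y_3-(\underline{C}+2V-\overline{V})u_2+(\overline{C}-\underline{C}-2V)u_3. \end{align*} Let $A\subset\mathbb{R}^8$ be the set of points $(x_1,x_2,x_3,y_1,y_2,y_3,u_2,u_3)$ satisfying \begin{align*} & u_2+u_3\le y_3,\quad y_1+u_2+u_3\le1,\quad u_2\ge y_2-y_1,\quad u_3\ge y_3-y_2,\quad u_2\ge0,\quad u_3\ge0,\\ & x_1\ge\underline{C}y_1,\quad x_2\ge\underline{C}y_2,\quad x_3\ge\underline{C}y_3,\\ & x_1\le\overline{V}y_1+(\overline{C}-\overline{V})(y_2-u_2),\\ & x_2\le\overline{V}y_2+(\overline{C}-\overline{V})(y_3-u_3-u_2),\\ & x_3\le\overline{C}y_3-(\overline{C}-\overline{V})u_3,\\ & x_2-x_1\le(\underline{C}+V)y_2-\underline{C}y_1-(\underline{C}+V-\overline{V})u_2,\\ & x_3-x_2\le(\underline{C}+V)y_3-\underline{C}y_2-(\underline{C}+V-\overline{V})u_3,\\ & x_1-x_2\le\overline{V}y_1-(\overline{V}-V)y_2-(\underline{C}+V-\overline{V})u_2,\\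 & x_2-x_3\le\overline{V}y_2-(\overline{V}-V)y_3-(\underline{C}+V-\overline{V})u_3,\\ & x_1-x_2+x_3\le\overline{V}y_1-(\overline{V}-V)y_2+\overline{V}y_3+(\overline{C}-\overline{V})(y_3-u_3-u_2),\\ & x_1-x_2+x_3\ge\underline{C}y_1-(\underline{C}+V)y_2+\underline{C}y_3, \end{align*} and let $B\subset\mathbb{R}^8$ be the set of points $(x_1,x_2,x_3,y_1,y_2,y_3,u_2,u_3)$ satisfying \begin{align*} & u_2\ge y_2-y_1,\quad u_3\ge y_3-y_2,\quad u_2\ge0,\quad u_3\ge0,\quad x_1\ge\underline{C}y_1,\quad x_2\ge\underline{C}y_2,\quad x_3\ge\underline{C}y_3,\\ & u_2\le y_2,\quad u_3\le y_3,\quad y_1+u_2\le1,\quad y_2+u_3\le1,\\ & x_1\le\overline{V}y_1+(\overline{C}-\overline{V})(y_2-u_2),\\ & x_2\le\overline{C}y_2-(\overline{C}-\overline{V})u_2,\\ & x_2\le\overline{V}y_2+(\overline{C}-\overline{V})(y_3-u_3),\\ & x_3\le\overline{C}y_3-(\overline{C}-\overline{V})u_3,\\ & x_2-x_1\le(\underline{C}+V)y_2-\underline{C}y_1-(\underline{C}+V-\overline{V})u_2,\\ & x_3-x_2\le(\underline{C}+V)y_3-\underline{C}y_2-(\underline{C}+V-\overline{V})u_3,\\ & x_1-x_2\le\overline{V}y_1-(\overline{V}-V)y_2-(\underline{C}+V-\overline{V})u_2,\\ & x_2-x_3\le\overline{V}y_2-(\overline{V}-V)y_3-(\underline{C}+V-\overline{V})u_3.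 \end{align*} (i) If $\overline{C}-\underline{C}-2V\ge0$, then $\mathrm{conv}(P)$ equals the set of points of $A$ satisfying $(\mathrm{F1})$ and $(\mathrm{F2})$ when $L=\ell=2$, and equals the set of points of $B$ satisfying $(\mathrm{F1})$ and $(\mathrm{F2})$ when $L=\ell=1$. (ii) If $\overline{C}-\underline{C}-2V<0$, then $\mathrm{conv}(P)=A$ when $L=\ell=2$, and $\mathrm{conv}(P)=B$ when $L=\ell=1$.
   Context: $T$ is the number of time periods, $L,\ell$ are positive integers (minimum-up and minimum-down time), and $\underline{C},\overline{C},\overline{V},V$ are real parameters (generation lower bound, generation upper bound, start-up/shut-down ramp rate, ramp rate in the stable region) with $0\le\underline{C}\le\overline{V}\le\overline{C}$ and $V>0$. For integers $a,b$, $[a,b]_{\mathbb{Z}}$ is the set of integers $i$ with $a\le i\le b$. $P$ is the set of $(x,y,u)\in\mathbb{R}_+^T\times\{0,1\}^T\times\{0,1\}^{T-1}$, with $x=(x_1,\dots,x_T)$, $y=(y_1,\dots,y_T)$, $u=(u_2,\dots,u_T)$, such that \begin{align*} &\textstyle\sum_{i=t-L+1}^{t}u_i\le y_t,\ t\in[L+1,T]_{\mathbb{Z}};\qquad \sum_{i=t-\ell+1}^{t}u_i\le 1-y_{t-\ell},\ t\in[\ell+1,T]_{\mathbb{Z}};\\ &y_t-y_{t-1}-u_t\le 0,\ t\in[2,T]_{\mathbb{Z}};\qquad \underline{C}y_t\le x_t\le\overline{C}y_t,\ t\in[1,T]_{\mathbb{Z}};\\ &x_t-x_{t-1}\le Vy_{t-1}+\overline{V}(1-y_{t-1}),\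 t\in[2,T]_{\mathbb{Z}};\qquad x_{t-1}-x_t\le Vy_t+\overline{V}(1-y_t),\ t\in[2,T]_{\mathbb{Z}}. \end{align*} $\mathrm{conv}(P)$ denotes the convex hull of $P$. *)

(* Defs.v *)
From mathcomp Require Import all_boot all_order all_algebra.
From mathcomp Require Import boolp classical_sets reals convex.
Set Implicit Arguments.
Unset Strict Implicit.
Unset Printing Implicit Defensive.
Import Order.TTheory GRing.Theory Num.Theory.
Local Open Scope classical_set_scope.
Local Open Scope ring_scope.

(* (x, y, u) with x = (x_1, ..., x_T), y = (y_1, ..., y_T) and
   u = (u_2, ..., u_T). *)
Definition ucpoint (R : realType) (T : nat) : lmodType R :=
  ('rV[R]_T * 'rV[R]_T * 'rV[R]_(T.-1))%type.

(* The entry of index i of a vector whose entries are indexed by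
   k, k + 1, ..., k + n - 1; only used for i in that range. *)
Definition entry (R : realType) (k n : nat) (v : 'rV[R]_n) (i : nat) : R :=
  oapp (fun j : 'I_n => v 0 j) 0 (insub (i - k)%N).

Lemma entryE (R : realType) (k n : nat) (v : 'rV[R]_n) (j : 'I_n) :
  entry k v (k + j) = v 0 j.
Proof. by rewrite /entry addKn valK. Qed.

Definition x_ (R : realType) (T : nat) (p : ucpoint R T) (t : nat) : R :=
  entry 1 p.1.1 t.
Definition y_ (R : realType) (T : nat) (p : ucpoint R T) (t : nat) : R :=
  entry 1 p.1.2 t.
Definition u_ (R : realType) (T : nat) (p : ucpoint R T) (t : nat) : R :=
  entry 2 p.2 t.

Definition conv_hull (R : realType) (E : lmodType R) (S : set E) : set E :=
  smallest (@convex_set R E) S.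

(* Generation bounds Cl <= Cu, start-up/shut-down ramp rate Vb, stable ramp
   rate V, minimum-up time L, minimum-down time l. *)
Definition Pset (R : realType) (T L l : nat) (Cl Cu Vb V : R) :
    set (ucpoint R T) :=
  [set p | let x := x_ p in let y := y_ p in let u := u_ p in
     (forall t, (1 <= t <= T)%N -> 0 <= x t) /\
     (forall t, (1 <= t <= T)%N -> y t = 0 \/ y t = 1) /\
     (forall t, (2 <= t <= T)%N -> u t = 0 \/ u t = 1) /\
     (forall t, (L + 1 <= t <= T)%N ->
        \sum_(t - L + 1 <= i < t.+1) u i <= y t) /\
     (forall t, (l + 1 <= t <= T)%N ->
        \sum_(t - l + 1 <= i < t.+1) u i <= 1 - y (t - l)%N) /\
     (forall t, (2 <= t <= T)%N -> y t - y (t - 1)%N - u t <= 0) /\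
     (forall t, (1 <= t <= T)%N -> Cl * y t <= x t /\ x t <= Cu * y t) /\
     (forall t, (2 <= t <= T)%N ->
        x t - x (t - 1)%N <= V * y (t - 1)%N + Vb * (1 - y (t - 1)%N)) /\
     (forall t, (2 <= t <= T)%N ->
        x (t - 1)%N - x t <= V * y t + Vb * (1 - y t))].
Arguments Pset {R} T%_N L%_N l%_N Cl Cu Vb V _.

Definition F1 (R : realType) (Cl Cu Vb V : R) : set (ucpoint R 3) :=
  [set p | let x1 := x_ p 1 in let x3 := x_ p 3 in
     let y1 := y_ p 1 in let y3 := y_ p 3 in
     let u2 := u_ p 2 in let u3 := u_ p 3 in
     x3 - x1 <= (Cl + 2 * V) * y3 - Cl * y1 - (Cl + 2 * V - Vb) * u3
                  + (Cu - Cl - 2 * V) * u2].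

Definition F2 (R : realType) (Cl Cu Vb V : R) : set (ucpoint R 3) :=
  [set p | let x1 := x_ p 1 in let x3 := x_ p 3 in
     let y1 := y_ p 1 in let y2 := y_ p 2 in let y3 := y_ p 3 in
     let u2 := u_ p 2 in let u3 := u_ p 3 in
     x1 - x3 <= Vb * y1 + (Cu - Vb) * y2 - (Cu - 2 * V) * y3
                  - (Cl + 2 * V - Vb) * u2 + (Cu - Cl - 2 * V) * u3].

Definition Aset (R : realType) (Cl Cu Vb V : R) : set (ucpoint R 3) :=
  [set p | let x1 := x_ p 1 in let x2 := x_ p 2 in let x3 := x_ p 3 in
     let y1 := y_ p 1 in let y2 := y_ p 2 in let y3 := y_ p 3 in
     let u2 := u_ p 2 in let u3 := u_ p 3 in
     u2 + u3 <= y3 /\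
     y1 + u2 + u3 <= 1 /\
     u2 >= y2 - y1 /\
     u3 >= y3 - y2 /\
     u2 >= 0 /\
     u3 >= 0 /\
     x1 >= Cl * y1 /\
     x2 >= Cl * y2 /\
     x3 >= Cl * y3 /\
     x1 <= Vb * y1 + (Cu - Vb) * (y2 - u2) /\
     x2 <= Vb * y2 + (Cu - Vb) * (y3 - u3 - u2) /\
     x3 <= Cu * y3 - (Cu - Vb) * u3 /\
     x2 - x1 <= (Cl + V) * y2 - Cl * y1 - (Cl + V - Vb) * u2 /\
     x3 - x2 <= (Cl + V) * y3 - Cl * y2 - (Cl + V - Vb) * u3 /\
     x1 - x2 <= Vb * y1 - (Vb - V) * y2 - (Cl + V - Vb) * u2 /\
     x2 - x3 <= Vb * y2 - (Vb - V) * y3 - (Cl + V - Vb) * u3 /\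
     x1 - x2 + x3 <= Vb * y1 - (Vb - V) * y2 + Vb * y3
                        + (Cu - Vb) * (y3 - u3 - u2) /\
     x1 - x2 + x3 >= Cl * y1 - (Cl + V) * y2 + Cl * y3].

Definition Bset (R : realType) (Cl Cu Vb V : R) : set (ucpoint R 3) :=
  [set p | let x1 := x_ p 1 in let x2 := x_ p 2 in let x3 := x_ p 3 in
     let y1 := y_ p 1 in let y2 := y_ p 2 in let y3 := y_ p 3 in
     let u2 := u_ p 2 in let u3 := u_ p 3 in
     u2 >= y2 - y1 /\
     u3 >= y3 - y2 /\
     u2 >= 0 /\
     u3 >= 0 /\
     x1 >= Cl * y1 /\
     x2 >= Cl * y2 /\
     x3 >= Cl * y3 /\
     u2 <= y2 /\
     u3 <= y3 /\
     y1 + u2 <= 1 /\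
     y2 + u3 <= 1 /\
     x1 <= Vb * y1 + (Cu - Vb) * (y2 - u2) /\
     x2 <= Cu * y2 - (Cu - Vb) * u2 /\
     x2 <= Vb * y2 + (Cu - Vb) * (y3 - u3) /\
     x3 <= Cu * y3 - (Cu - Vb) * u3 /\
     x2 - x1 <= (Cl + V) * y2 - Cl * y1 - (Cl + V - Vb) * u2 /\
     x3 - x2 <= (Cl + V) * y3 - Cl * y2 - (Cl + V - Vb) * u3 /\
     x1 - x2 <= Vb * y1 - (Vb - V) * y2 - (Cl + V - Vb) * u2 /\
     x2 - x3 <= Vb * y2 - (Vb - V) * y3 - (Cl + V - Vb) * u3].

(* Main.v *)
(* After the shift z_t = x_t - Cl y_t, a point is a convex combination of feasible
   points exactly when its on/off patterns (y_1, y_2, y_3) can be given masses and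
   z can be split among the patterns, each part obeying the bounds and ramp limits
   scaled by the mass of its pattern. Once the period-2 parts are fixed, periods 1
   and 3 decouple and only ask for intervals, so for fixed masses a split exists iff
   finitely many linear inequalities hold, which are the facets.
   For L = l = 2 the masses are linear functions of (y, u). For L = l = 1 the masses
   of the patterns with y_2 = 1 depend on the mass e of 010: the facets involving
   x_2 or x_1 - x_2 + x_3 bound e from below, (F1) and (F2) bound it from above, and
   the largest lower bound is compatible with all upper ones. The mass of 101
   only couples parts that have no interaction, so it can be as small as possible. *)
Require Import Defs.
From mathcomp Require Import all_boot all_order all_algebra.
From mathcomp Require Import boolp classical_sets reals convex.
From mathcomp Require Import interval_inference lra ring.
Set Implicit Arguments.
Unset Strict Implicit.
Unset Printing Implicit Defensive.
Import Order.TTheory GRing.Theory Num.Theory.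
Local Open Scope classical_set_scope.
Local Open Scope ring_scope.

(** * Splitting the outputs among the on/off patterns *)

(** The sum of two intervals is an interval; the first summand is taken as small as the bound [u2]
    on the second allows. *)
Lemma split2 (R : realFieldType) (l1 u1 l2 u2 S : R) :
  l1 <= u1 -> l2 <= u2 -> l1 + l2 <= S <= u1 + u2 ->
  exists s1 s2, [/\ s1 + s2 = S, l1 <= s1 <= u1 & l2 <= s2 <= u2].
Proof.
move=> h1 h2 hS; exists (Num.max l1 (S - u2)), (S - Num.max l1 (S - u2)).
by case: (leP l1 (S - u2)) => ?; split; lra.
Qed.

Lemma split3 (R : realFieldType) (l1 u1 l2 u2 l3 u3 S : R) :
  l1 <= u1 -> l2 <= u2 -> l3 <= u3 -> l1 + l2 + l3 <= S <= u1 + u2 + u3 ->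
  exists s1 s2 s3, [/\ s1 + s2 + s3 = S, l1 <= s1 <= u1, l2 <= s2 <= u2 &
    l3 <= s3 <= u3].
Proof.
move=> h1 h2 h3 hS.
have [|||t [s3 [e3 ht h3']]] := @split2 _ (l1 + l2) (u1 + u2) l3 u3 S;
  [lra|lra|lra|].
have [|||s1 [s2 [e12 h1' h2']]] := @split2 _ l1 u1 l2 u2 t; [lra|lra|lra|].
by exists s1, s2, s3; split=> //; lra.
Qed.

Lemma max3_ex (R : realFieldType) (a b c : R) :
  exists m, [/\ a <= m, b <= m, c <= m & [\/ m = a, m = b | m = c]].
Proof.
have [ab|ba] := leP a b; [have [bc|cb] := leP b c|have [ac|ca] := leP a c].
- by exists c; split; [lra|lra|lra|constructor 3].
- by exists b; split; [lra|lra|lra|constructor 2].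
- by exists c; split; [lra|lra|lra|constructor 3].
- by exists a; split; [lra|lra|lra|constructor 1].
Qed.

Lemma min3_ex (R : realFieldType) (a b c : R) :
  exists m, [/\ m <= a, m <= b, m <= c & [\/ m = a, m = b | m = c]].
Proof.
have [m [ha hb hc h]] := max3_ex (- a) (- b) (- c).
exists (- m); split; [lra|lra|lra|].
by case: h => ->; rewrite opprK; [constructor 1|constructor 2|constructor 3].
Qed.

(** With the period-2 parts [p1], [p2] fixed, [x1] and [x2] range over independent intervals whose
    ends are maxima and minima of two linear terms. The last eight hypotheses are all the ways of
    choosing one term for each. *)
Lemma ramp_split (R : realFieldType) (X a d1 d2 v1 v2 p1 p2 : R) :
  0 <= a -> 0 <= v1 -> 0 <= v2 -> 0 <= p1 <= d1 -> 0 <= p2 <= d2 ->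
  0 <= X -> p1 - v1 <= X -> p2 - v2 <= X -> p1 + p2 - v1 - v2 <= X ->
  X <= a + d1 + d2 -> X <= a + p1 + v1 + d2 -> X <= a + d1 + p2 + v2 ->
  X <= a + p1 + v1 + p2 + v2 ->
  exists x x1 x2, [/\ x + x1 + x2 = X, 0 <= x <= a,
    (0 <= x1 <= d1) && (- v1 <= x1 - p1 <= v1) &
    (0 <= x2 <= d2) && (- v2 <= x2 - p2 <= v2)].
Proof.
move=> ha h1 h2 /andP[p10 p1d] /andP[p20 p2d] l0 l1 l2 l12 u0 u1 u2 u12.
have [||||x [x1 [x2 [e hx]]]] :=
  @split3 _ 0 a (Num.max 0 (p1 - v1)) (Num.min d1 (p1 + v1))
    (Num.max 0 (p2 - v2)) (Num.min d2 (p2 + v2)) X.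
- exact: ha.
- by rewrite ge_max !le_min; lra.
- by rewrite ge_max !le_min; lra.
- apply/andP; split.
    by case: (leP 0 (p1 - v1)) => _; case: (leP 0 (p2 - v2)) => _; lra.
  by case: (leP d1 (p1 + v1)) => _; case: (leP d2 (p2 + v2)) => _; lra.
rewrite !ge_max !le_min => k1 k2; exists x, x1, x2.
by split=> //; clear - k1 k2; lra.
Qed.

(* The indices 1, 2, 3 stand for the on/off patterns 110, 011, 111, and the
   parameters a, c, e belong to 100, 001, 010. If a pattern has mass m, then
   v = m V, b = m (Vb - Cl) and d = m (Cu - Cl); a, c, e are of the form b. *)
Definition pattern_params (R : realFieldType)
    (a c e v1 b1 d1 v2 b2 d2 v3 d3 : R) :=
  [/\ [/\ 0 <= a, 0 <= c & 0 <= e], [/\ 0 <= v1, v1 <= b1, b1 <= d1 & d1 <= b1 + v1],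
    [/\ 0 <= v2, v2 <= b2, b2 <= d2 & d2 <= b2 + v2] & 0 <= v3 /\ v3 <= d3].

(** [X1], [X2], [X3] are the shifted outputs. The last pair becomes (F1) and (F2) when 010 has mass
    0. *)
Definition facets (R : realFieldType)
    (X1 X2 X3 a c e v1 b1 d1 v2 b2 d2 v3 d3 : R) :=
  [/\ [/\ 0 <= X1, 0 <= X2 & 0 <= X3],
    [/\ X1 <= a + d1 + d3, X2 <= e + b1 + b2 + d3 & X3 <= c + d2 + d3],
    [/\ X2 - X1 <= e + v1 + b2 + v3, X2 - X3 <= e + b1 + v2 + v3,
      X3 - X2 <= c + v2 + v3 & X1 - X2 <= a + v1 + v3],
    X1 - X2 + X3 <= a + c + v1 + v2 + d3 + v3 /\
      - e - v1 - v2 - v3 <= X1 - X2 + X3 &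
    X3 - X1 <= c + d2 + 2 * v3 /\ X1 - X3 <= a + d1 + 2 * v3].

(* Fourier-Motzkin elimination of the outputs of periods 1 and 3 constrains
   p + r and q + r; since p + q + r = X2, these are bounds on q and p. *)
Lemma middle_split (R : realFieldType)
    (X1 X2 X3 a c v1 b1 d1 v2 b2 d2 v3 d3 : R) :
  pattern_params a c 0 v1 b1 d1 v2 b2 d2 v3 d3 ->
  facets X1 X2 X3 a c 0 v1 b1 d1 v2 b2 d2 v3 d3 ->
  exists p q r, [/\ p + q + r = X2,
    [/\ 0 <= p, p <= b1, p <= X1 + v1, X1 - a - v1 - d3 <= p &
        X2 - v2 - v3 - X3 <= p <= X2 + v2 + v3 - (X3 - c)],
    [/\ 0 <= q, q <= b2, q <= X3 + v2, X3 - c - v2 - d3 <= q &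
        X2 - v1 - v3 - X1 <= q <= X2 + v1 + v3 - (X1 - a)] &
    [/\ 0 <= r, r <= d3, r <= X1 + v3, r <= X3 + v3 &
        Num.max (X1 - a - d1 - v3) (X3 - c - d2 - v3) <= r]].
Proof.
move=> [[ha hc _] [v10 vb1 bd1 db1] [v20 vb2 bd2 db2] [v30 vd3]].
move=> [[x10 x20 x30] [x1u x2u x3u] [h21 h23 h32 h12] [hs hl] [f1 f2]].
rewrite ?(oppr0, add0r) in x2u h21 h23 hl.
(* Each of [p], [q], [r] gets its tightest lower and upper bound. Replacing every maximum or minimum
   by the term attaining it turns nonemptiness and the bounds on the sum into finitely many linear
   consequences of the facets. *)
have [lp [lp1 lp2 lp3 lpE]] := max3_ex 0 (X2 - v2 - v3 - X3) (X1 - a - v1 - d3).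
have [up [up1 up2 up3 upE]] := min3_ex b1 (X1 + v1) (X2 + v2 + v3 - (X3 - c)).
have [lq [lq1 lq2 lq3 lqE]] := max3_ex 0 (X2 - v1 - v3 - X1) (X3 - c - v2 - d3).
have [uq [uq1 uq2 uq3 uqE]] := min3_ex b2 (X3 + v2) (X2 + v1 + v3 - (X1 - a)).
have [lr [lr1 lr2 lr3 lrE]] := max3_ex 0 (X1 - a - d1 - v3) (X3 - c - d2 - v3).
have [ur [ur1 ur2 ur3 urE]] := min3_ex d3 (X1 + v3) (X3 + v3).
have [||||p [q [r [pqr /andP[hp hp'] /andP[hq hq'] /andP[hr hr']]]]] :=
  @split3 _ lp up lq uq lr ur X2.
- clear - lpE upE ha hc v10 v20 v30 vb1 bd1 bd2 db1 db2 vd3 x10 x1u h23 h32 hs hl.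
  by case: lpE => ->; case: upE => ->; lra.
- clear - lqE uqE ha hc v10 v20 v30 vb2 bd1 bd2 db1 db2 vd3 x30 x3u h21 h12 hs hl.
  by case: lqE => ->; case: uqE => ->; lra.
- clear - lrE urE ha hc v30 v10 v20 vb1 vb2 bd1 bd2 vd3 x10 x30 x1u x3u f1 f2.
  by case: lrE => ->; case: urE => ->; lra.
- apply/andP; split.
    clear - lpE lqE lrE ha hc v30 vb1 vb2 bd1 bd2 db1 db2 vd3 x10 x20 x30 x1u x3u
      h21 h23 h32 h12 hs hl f1 f2.
    by case: lpE => ->; case: lqE => ->; case: lrE => ->; lra.
  clear - upE uqE urE ha hc v30 vb1 vb2 bd1 bd2 db1 db2 vd3 x10 x30 x1u x2u x3u
    h21 h23 h32 h12 hs hl f1 f2.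
  by case: upE => ->; case: uqE => ->; case: urE => ->; lra.
clear - pqr hp hp' hq hq' hr hr' lp1 lp2 lp3 lq1 lq2 lq3 lr1 lr2 lr3
  up1 up2 up3 uq1 uq2 uq3 ur1 ur2 ur3.
exists p, q, r; split=> //; split; rewrite ?ge_max; try (apply/andP; split);
  by first [exact: le_trans hp | exact: le_trans hq | exact: le_trans hr
           | exact: le_trans hp' _ | exact: le_trans hq' _
           | exact: le_trans hr' _].
Qed.

(** Parts by pattern: [x1] for 100, [x3] for 001, [w] for 010, [p1], [p] for 110, [q], [q3] for 011,
    and [r1], [r], [r3] for 111. *)
Definition splits (R : realFieldType)
    (X1 X2 X3 a c e v1 b1 d1 v2 b2 d2 v3 d3 : R) :=
  exists x1 p1 r1 w p q r q3 r3 x3,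
  [/\ x1 + p1 + r1 = X1, w + p + q + r = X2, x3 + q3 + r3 = X3,
      [&& 0 <= w <= e, 0 <= x1 <= a & 0 <= x3 <= c] &
  [/\ [&& 0 <= p1 <= d1, 0 <= p <= b1 & - v1 <= p1 - p <= v1],
  [&& 0 <= q3 <= d2, 0 <= q <= b2 & - v2 <= q3 - q <= v2] &
  [&& 0 <= r1 <= d3, 0 <= r <= d3, 0 <= r3 <= d3, - v3 <= r1 - r <= v3
    & - v3 <= r3 - r <= v3]]].

Lemma facets_split0 (R : realFieldType)
    (X1 X2 X3 a c v1 b1 d1 v2 b2 d2 v3 d3 : R) :
  pattern_params a c 0 v1 b1 d1 v2 b2 d2 v3 d3 ->
  facets X1 X2 X3 a c 0 v1 b1 d1 v2 b2 d2 v3 d3 ->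
  splits X1 X2 X3 a c 0 v1 b1 d1 v2 b2 d2 v3 d3.
Proof.
move=> hpar hfac; have [p [q [r [pqr]]]] := middle_split hpar hfac.
case: hpar => [[ha hc _] [v10 _ bd1 _] [v20 _ bd2 _] [v30 _]].
case: hfac => [[x10 _ x30] [x1u _ x3u] _ _ _].
move=> [p0 pb1 pX1 lp /andP[lp' pu]] [q0 qb2 qX3 lq /andP[lq' qu]].
move=> [r0 rd3 rX1 rX3]; rewrite ge_max => /andP[lr lr'].
have hp : 0 <= p <= d1 by rewrite p0 (le_trans pb1 bd1).
have hq : 0 <= q <= d2 by rewrite q0 (le_trans qb2 bd2).
have hr : 0 <= r <= d3 by rewrite r0.
(* Periods 1 and 3 are now independent; the bounds on [p + r] here, and on [q + r] below, come from
   those on [q] and [p] through [pqr]. *)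
have [||||||x1 [p1 [r1 [e1 hx1 /andP[hp1 hp1'] /andP[hr1 hr1']]]]] :=
  @ramp_split _ X1 a d1 d3 v1 v3 p r ha v10 v30 hp hr x10 _ _ _ x1u _ _ _.
- by clear - pX1; lra.
- by clear - rX1; lra.
- by clear - pqr lq'; lra.
- by clear - lp; lra.
- by clear - lr; lra.
- by clear - pqr qu; lra.
have [||||||x3 [q3 [r3 [e3 hx3 /andP[hq3 hq3'] /andP[hr3 hr3']]]]] :=
  @ramp_split _ X3 c d2 d3 v2 v3 q r hc v20 v30 hq hr x30 _ _ _ x3u _ _ _.
- by clear - qX3; lra.
- by clear - rX3; lra.
- by clear - pqr lp'; lra.
- by clear - lq; lra.
- by clear - lr'; lra.
- by clear - pqr pu; lra.
exists x1, p1, r1, 0, p, q, r, q3, r3, x3; split; rewrite ?add0r //.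
  by rewrite lexx hx1.
by split; rewrite ?hp1 ?hp1' ?hq3 ?hq3' ?hr1 ?hr1' ?hr3 ?hr3' ?p0 ?pb1 ?q0 ?qb2 ?hr.
Qed.

(** Removing the part [w] of 010 replaces [X2] by [X2 - w] and leaves a problem without 010. The
    facets of that problem bound [w] from both sides; [w] is the largest lower bound, and the given
    facets put it below [e] and every other upper bound. *)
Lemma facets_split (R : realFieldType)
    (X1 X2 X3 a c e v1 b1 d1 v2 b2 d2 v3 d3 : R) :
  pattern_params a c e v1 b1 d1 v2 b2 d2 v3 d3 ->
  facets X1 X2 X3 a c e v1 b1 d1 v2 b2 d2 v3 d3 ->
  splits X1 X2 X3 a c e v1 b1 d1 v2 b2 d2 v3 d3.
Proof.
move=> [[ha hc he] h1 h2 h3] [[x10 x20 x30] [x1u x2u x3u] [h21 h23 h32 h12]].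
move=> [hs hl] [f1 f2].
have [m [m0 m1 m2 mE]] :=
  max3_ex 0 (X2 - b1 - b2 - d3) (X2 - X1 - v1 - b2 - v3).
have [w [w0 w1 w2 wE]] :=
  max3_ex m (X2 - X3 - b1 - v2 - v3) (X2 - X1 - X3 - v1 - v2 - v3).
have {mE wE} [u1 u2 u3 u4 u5] : [/\ w <= e, w <= X2,
    w <= X2 - X3 + c + v2 + v3, w <= X2 - X1 + a + v1 + v3 &
    w <= X2 - X1 - X3 + a + c + v1 + v2 + d3 + v3].
  case: h1 h2 h3 => [v10 vb1 bd1 db1] [v20 vb2 bd2 db2] [v30 vd3].
  clear m0 m1 m2 w0 w1 w2.
  by case: wE => ->; [case: mE => ->|..]; split; lra.
have [||x1 [p1 [r1 [w' [p [q [r [q3 [r3 [x3 [E1 E2 E3 /and3P[Ew hx1 hx3] H]]]]]]]]]]] :=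
  @facets_split0 _ X1 (X2 - w) X3 a c v1 b1 d1 v2 b2 d2 v3 d3.
- by split.
- split=> //.
  + by split=> //; clear - u2; lra.
  + by split=> //; clear - m1 w0; lra.
  + split; [clear - m2 w0; lra|clear - w1; lra|clear - u3; lra|clear - u4; lra].
  + by split; [clear - u5; lra|clear - w2; lra].
exists x1, p1, r1, w, p, q, r, q3, r3, x3; split => //.
  by clear - E2 Ew; lra.
by rewrite u1 hx1 hx3 (le_trans m0 w0).
Qed.

(** * The mass of the pattern 010 *)

(* al and be are the masses of 01* and *10 and Y that of *1*; if 010 has mass e,
   then 110, 011, 111 have masses s1, s2, s3. *)
Definition mass010_ok (R : realFieldType) (X1 X2 X3 a c al be Y V B D e : R) :=
  let s1 := be - e in let s2 := al - e in let s3 := Y - al - be + e in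
  [/\ 0 <= e, 0 <= s1, 0 <= s2, 0 <= s3 &
  [/\ X2 <= B * e + B * s1 + B * s2 + D * s3,
   X1 - X2 + X3 <= a + c + V * s1 + V * s2 + D * s3 + V * s3,
   - (B * e) - V * s1 - V * s2 - V * s3 <= X1 - X2 + X3,
   X3 - X1 <= c + D * s2 + 2 * (V * s3) &
   X1 - X3 <= a + D * s1 + 2 * (V * s3)]].

(** Division by zero yields zero, so for [k = 0] the bound [A / k <= e] says nothing about [A],
    whose sign is then supplied separately. *)
Lemma le_mul_of_div (R : realFieldType) (k A e : R) :
  0 <= k -> (k = 0 -> A <= 0) -> A / k <= e -> A <= k * e.
Proof.
rewrite le_eqVlt => /orP[/eqP <- /(_ erefl) ? _|k0 _]; first by rewrite mul0r.
by rewrite ler_pdivrMr // mulrC.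
Qed.

(** A lower bound with zero slope evaluates to 0, which is already a candidate for [e]. *)
Lemma div_cases (R : realFieldType) (k A e : R) :
  0 <= k -> e = A / k -> e = 0 \/ 0 < k /\ k * e = A.
Proof.
rewrite le_eqVlt => /orP[/eqP <- ->|k0 ->]; first by left; rewrite invr0 mulr0.
by right; rewrite mulrC divfK ?gt_eqF.
Qed.

(** As [2 * V <= D], the conditions from (F1), (F2) bound [e] from above, as do [e <= al] and
    [e <= be]; all others bound it from below. The largest lower bound is taken. *)
Lemma mass010_ex_long (R : realFieldType) (X1 X2 X3 a c al be Y V B D : R) :
 0 <= a -> 0 <= c -> 0 <= al -> 0 <= be -> al <= Y -> be <= Y ->
 0 < V -> V <= B -> B <= D -> D <= B + V -> 2 * V <= D ->
 0 <= X1 -> 0 <= X2 -> 0 <= X3 -> X1 <= a + D * (Y - al) ->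
 X3 <= c + D * (Y - be) -> X2 <= D * Y - (D - B) * al ->
 X2 <= D * Y - (D - B) * be ->
 X2 - X1 <= V * (Y - al) + B * al -> X2 - X3 <= V * (Y - be) + B * be ->
 X3 - X2 <= c + V * (Y - be) -> X1 - X2 <= a + V * (Y - al) ->
 X3 - X1 <= c + D * al + 2 * V * (Y - al - be) ->
 X1 - X3 <= a + D * be + 2 * V * (Y - al - be) ->
 exists e, mass010_ok X1 X2 X3 a c al be Y V B D e.
Proof.
move=> ha hc hal hbe hal' hbe' hV hVB hBD hD hDV.
move=> h1 h2 h3 h4 h5 h6 h7 h8 h9 h10 h11 h12 h13.
(* Solved for [e], the first three of the five output inequalities in [mass010_ok] read
   [A3 <= (D - B) * e], [A4 <= (D - V) * e] and [A5 <= (B - V) * e]. *)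
set A3 := X2 - B * Y - (D - B) * (Y - al - be).
set A4 := X1 - X2 + X3 - a - c - V * (al + be) - (D + V) * (Y - al - be).
set A5 := - (X1 - X2 + X3) - V * (al + be) - V * (Y - al - be).
have kBD : 0 <= D - B by lra.
have kVD : 0 <= D - V by lra.
have kVB : 0 <= B - V by lra.
have k0BD : D - B = 0 -> A3 <= 0.
  move=> E; have EB : B = D by lra.
  by rewrite EB in h6; rewrite /A3 EB; clear - h6; lra.
have k0VB : B - V = 0 -> A5 <= 0.
  move=> E; have EB : B = V by lra.
  by rewrite EB in h8; rewrite /A5; clear -h8 h3; lra.
have k0VD : D - V = 0 -> A4 <= 0 by clear - hV hDV; lra.
have [m [m0 mn m3 mE]] := max3_ex 0 (- (Y - al - be)) (A3 / (D - B)).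
have [e [me e4 e5 eE]] := max3_ex m (A4 / (D - V)) (A5 / (B - V)).
have e0 := le_trans m0 me; have en := le_trans mn me; have e3 := le_trans m3 me.
have {}e3 := le_mul_of_div kBD k0BD e3; have {}e4 := le_mul_of_div kVD k0VD e4.
have {}e5 := le_mul_of_div kVB k0VB e5.
have {mE} eE : [\/ e = 0, e = - (Y - al - be),
    0 < D - B /\ (D - B) * e = A3 |
    0 < D - V /\ (D - V) * e = A4 \/
    0 < B - V /\ (B - V) * e = A5].
  case: eE => [->|/(div_cases kVD)|/(div_cases kVB)].
  - case: mE => [->|->|/(div_cases kBD)[->|]];
      first [by constructor 1|by constructor 2|by constructor 3].
  - by case=> ?; [constructor 1|constructor 4; left].
  - by case=> ?; [constructor 1|constructor 4; right].
(* Every candidate is compared with [al] and [be], quotients after multiplication by their positive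
   slope. *)
have [eal ebe] : e <= al /\ e <= be.
  clear - eE ha hc hal hbe hal' hbe' hV hVB hBD hD hDV
    h1 h2 h3 h4 h5 h6 h7 h8 h9 h10 h11 h12 h13.
  case: eE => [->|->|[k0 E]|[[k0 E]|[k0 E]]]; split;
    first [by clear - hal hbe hal' hbe'; lra
      | rewrite -(ler_pM2l k0) E /A3 /A4 /A5; lra].
exists e.
have s10 : 0 <= be - e by lra.
have s20 : 0 <= al - e by lra.
have s30 : 0 <= Y - al - be + e by lra.
split=> //.
suff [f1 f2] : X3 - X1 <= c + D * (al - e) + 2 * (V * (Y - al - be + e)) /\
    X1 - X3 <= a + D * (be - e) + 2 * (V * (Y - al - be + e)).
  split=> //.
  - by clear - e3; rewrite /A3 in e3; lra.
  - by clear - e4; rewrite /A4 in e4; lra.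
  - by clear - e5; rewrite /A5 in e5; lra.
(* Products of masses with [V], [B - V] and [D - B]: given their signs, both upper bounds follow
   linearly. *)
have p1 := mulr_ge0 kVB s10.
have p2 := mulr_ge0 kVB s20.
have p3 := mulr_ge0 (ltW hV) s10.
have p4 := mulr_ge0 (ltW hV) s20.
have p5 := mulr_ge0 (ltW hV) s30.
have p6 := mulr_ge0 (ltW hV) e0.
have p7 := mulr_ge0 kVB e0.
have p8 := mulr_ge0 kBD s10.
have p9 := mulr_ge0 kBD s20.
clear e3 e4 e5 me en k0BD k0VB k0VD.
(* A tight lower bound on e gives an equation that, with the ramp limits, yields
   both upper bounds. *)
case: eE => [E|E|[k0 E]|[[k0 E]|[k0 E]]]; rewrite /A3 /A4 /A5 in E.
- by rewrite E; clear -h12 h13; split; lra.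
- by rewrite E; clear -h1 h3 h4 h5; split; lra.
- by split; lra.
- by split; lra.
- by split; lra.
Qed.

(** As [D <= 2 * V], raising [e] relaxes all five output inequalities, so the largest [e] leaving
    110 and 011 nonnegative mass works: the minimum of [al] and [be]. *)
Lemma mass010_ex_short (R : realFieldType) (X1 X2 X3 a c al be Y V B D : R) :
 0 <= a -> 0 <= c -> 0 <= al -> 0 <= be -> al <= Y -> be <= Y ->
 0 < V -> V <= B -> B <= D -> D <= B + V -> D <= 2 * V ->
 0 <= X1 -> 0 <= X2 -> 0 <= X3 -> X1 <= a + D * (Y - al) ->
 X3 <= c + D * (Y - be) -> X2 <= D * Y - (D - B) * al ->
 X2 <= D * Y - (D - B) * be ->
 X2 - X1 <= V * (Y - al) + B * al -> X2 - X3 <= V * (Y - be) + B * be ->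
 X3 - X2 <= c + V * (Y - be) -> X1 - X2 <= a + V * (Y - al) ->
 exists e, mass010_ok X1 X2 X3 a c al be Y V B D e.
Proof.
move=> ha hc hal hbe hal' hbe' hV hVB hBD hD hDV.
move=> h1 h2 h3 h4 h5 h6 h7 h8 h9 h10 h11.
have kVB : 0 <= B - V by lra.
have kBD : 0 <= D - B by lra.
have kD : 0 <= 2 * V - D by lra.
have [ab|ba] := leP al be; [exists al|exists be].
- have s1 : 0 <= be - al by lra.
  have s3 : 0 <= Y - be by lra.
  have p1 := mulr_ge0 kVB s1.
  have p2 := mulr_ge0 kD s3.
  have p3 := mulr_ge0 (ltW hV) s1.
  have p4 := mulr_ge0 kBD s1.
  split; try lra.
  by split; lra.
- have s1 : 0 <= al - be by lra.
  have s3 : 0 <= Y - al by lra.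
  have p1 := mulr_ge0 kVB s1.
  have p2 := mulr_ge0 kD s3.
  have p3 := mulr_ge0 (ltW hV) s1.
  have p4 := mulr_ge0 kBD s1.
  split; try lra.
  by split; lra.
Qed.

(** * Points, cones and the feasible set *)

Lemma entryD (R : realType) k n (v w : 'rV[R]_n) i :
  entry k (v + w) i = entry k v i + entry k w i.
Proof. by rewrite /entry; case: insub => [j|] /=; rewrite ?mxE ?addr0. Qed.

Lemma entryZ (R : realType) k n a (v : 'rV[R]_n) i :
  entry k (a *: v) i = a * entry k v i.
Proof. by rewrite /entry; case: insub => [j|] /=; rewrite ?mxE ?mulr0. Qed.

Section point.
Variable R : realType.
Implicit Types p q : ucpoint R 3.

Lemma x_D p q t : x_ (p + q) t = x_ p t + x_ q t.
Proof. exact: entryD. Qed.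

Lemma x_Z a p t : x_ (a *: p) t = a * x_ p t.
Proof. exact: entryZ. Qed.

Lemma y_D p q t : y_ (p + q) t = y_ p t + y_ q t.
Proof. exact: entryD. Qed.

Lemma y_Z a p t : y_ (a *: p) t = a * y_ p t.
Proof. exact: entryZ. Qed.

Lemma u_D p q t : u_ (p + q) t = u_ p t + u_ q t.
Proof. exact: entryD. Qed.

Lemma u_Z a p t : u_ (a *: p) t = a * u_ p t.
Proof. exact: entryZ. Qed.

Definition ucpointE := (x_D, y_D, u_D, x_Z, y_Z, u_Z).

Definition pt (x1 x2 x3 y1 y2 y3 u2 u3 : R) : ucpoint R 3 :=
  (\row_(i < 3) [:: x1; x2; x3]`_i, \row_(i < 3) [:: y1; y2; y3]`_i,
   \row_(i < 2) [:: u2; u3]`_i).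

Lemma entry_row k n (F : 'I_n -> R) (j : 'I_n) :
  entry k (\row_i F i) (k + j) = F j.
Proof. by rewrite entryE mxE. Qed.

Lemma ptE x1 x2 x3 y1 y2 y3 u2 u3 : let p := pt x1 x2 x3 y1 y2 y3 u2 u3 in
  ((x_ p 1 = x1) * (x_ p 2 = x2) * (x_ p 3 = x3) *
  (y_ p 1 = y1) * (y_ p 2 = y2) * (y_ p 3 = y3) *
  (u_ p 2 = u2) * (u_ p 3 = u3))%type.
Proof.
pose o0 := @Ordinal 3 0 isT; pose o1 := @Ordinal 3 1 isT.
pose o2 := @Ordinal 3 2 isT.
by do !split; [exact: (entry_row 1 _ o0)|exact: (entry_row 1 _ o1)
  |exact: (entry_row 1 _ o2)|exact: (entry_row 1 _ o0)
  |exact: (entry_row 1 _ o1)|exact: (entry_row 1 _ o2)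
  |exact: (entry_row 2 _ (@Ordinal 2 0 isT))
  |exact: (entry_row 2 _ (@Ordinal 2 1 isT))].
Qed.

Lemma ucpoint_eq p q :
  x_ p 1 = x_ q 1 -> x_ p 2 = x_ q 2 -> x_ p 3 = x_ q 3 ->
  y_ p 1 = y_ q 1 -> y_ p 2 = y_ q 2 -> y_ p 3 = y_ q 3 ->
  u_ p 2 = u_ q 2 -> u_ p 3 = u_ q 3 -> p = q.
Proof.
case: p q => [[x y] u] [[x' y'] u'] x1 x2 x3 y1 y2 y3 u2 u3.
congr (_, _, _); apply/rowP => i.
- by rewrite -!(entryE 1); case: i => [[|[|[|]]]].
- by rewrite -!(entryE 1); case: i => [[|[|[|]]]].
- by rewrite -!(entryE 2); case: i => [[|[|]]].
Qed.

Lemma ptD x1 x2 x3 y1 y2 y3 u2 u3 x1' x2' x3' y1' y2' y3' u2' u3' :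
  pt x1 x2 x3 y1 y2 y3 u2 u3 + pt x1' x2' x3' y1' y2' y3' u2' u3' =
  pt (x1 + x1') (x2 + x2') (x3 + x3') (y1 + y1') (y2 + y2') (y3 + y3')
     (u2 + u2') (u3 + u3').
Proof. by apply: ucpoint_eq; rewrite ?(x_D, y_D, u_D) !ptE. Qed.

End point.

(** The slice at height [l] of the homogenization of [C]: weighted parts can be added without
    dividing by their weights. At height 0 it holds only the zero vector, provided [C] is
    inhabited. *)
Definition cone (R : realType) (E : lmodType R) (C : set E) (l : R) (v : E) :=
  exists2 c, C c & v = l *: c.

Lemma coneD (R : realType) (E : lmodType R) (C : set E) (l m : R) (v w : E) :
  convex_set C -> 0 <= l -> 0 <= m -> cone C l v -> cone C m w ->
  cone C (l + m) (v + w).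
Proof.
move=> cC l0 m0 [c Cc ->] [d Cd ->].
have [lm0|lm_neq0] := eqVneq (l + m) 0.
  exists c => //; have [-> ->] : l = 0 /\ m = 0 by lra.
  by rewrite addr0 !scale0r addr0.
have lm_gt0 : 0 < l + m by rewrite lt_neqAle eq_sym lm_neq0 addr_ge0.
have t0 : 0 <= l / (l + m) by rewrite divr_ge0 // ltW.
have t1 : l / (l + m) <= 1 by rewrite ler_pdivrMr // mul1r lerDl.
exists ((l / (l + m)) *: c + (1 - l / (l + m)) *: d).
  by have /set_mem := cC c d (Itv01 t0 t1) (mem_set Cc) (mem_set Cd).
rewrite scalerDr !scalerA; congr (_ *: _ + _ *: _); by field.
Qed.

Section Pset3.
Variables (R : realType) (Cl Cu Vb V : R).
Implicit Types p : ucpoint R 3.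

Definition ramping p :=
  [/\ [/\ 0 <= x_ p 1, 0 <= x_ p 2 & 0 <= x_ p 3],
    [/\ Cl * y_ p 1 <= x_ p 1 <= Cu * y_ p 1, Cl * y_ p 2 <= x_ p 2 <= Cu * y_ p 2
      & Cl * y_ p 3 <= x_ p 3 <= Cu * y_ p 3],
    [/\ x_ p 2 - x_ p 1 <= V * y_ p 1 + Vb * (1 - y_ p 1)
      & x_ p 3 - x_ p 2 <= V * y_ p 2 + Vb * (1 - y_ p 2)] &
    [/\ x_ p 1 - x_ p 2 <= V * y_ p 2 + Vb * (1 - y_ p 2)
      & x_ p 2 - x_ p 3 <= V * y_ p 3 + Vb * (1 - y_ p 3)]].

Definition commitment p :=
  [/\ [/\ y_ p 1 = 0 \/ y_ p 1 = 1, y_ p 2 = 0 \/ y_ p 2 = 1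
      & y_ p 3 = 0 \/ y_ p 3 = 1],
    u_ p 2 = 0 \/ u_ p 2 = 1, u_ p 3 = 0 \/ u_ p 3 = 1,
    y_ p 2 - y_ p 1 - u_ p 2 <= 0 & y_ p 3 - y_ p 2 - u_ p 3 <= 0].

(** With both times equal to 2, only [t = 3] yields a minimum-up and a minimum-down constraint, each
    over the window of [u] at 2 and 3. *)
Lemma Pset_min2 p : Pset 3 2 2 Cl Cu Vb V p <->
  [/\ ramping p, commitment p, u_ p 2 + u_ p 3 <= y_ p 3
    & u_ p 2 + u_ p 3 <= 1 - y_ p 1].
Proof.
have sum23 : \sum_(3 - 2 + 1 <= i < 4) u_ p i = u_ p 2 + u_ p 3.
  by rewrite 2?big_ltn // big_geq // addr0.
split.
  move=> [x0 [y01 [u01 [up [down [uy [xb [ru rd]]]]]]]].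
  have := up 3 isT; have := down 3 isT; rewrite sum23 => d3 u3.
  have [[b1 b2] b3] := (xb 1 isT, xb 2 isT, xb 3 isT).
  split; last (exact: d3); last (exact: u3); split.
  - by split; apply: x0.
  - by split; apply/andP.
  - by split; [apply: (ru 2)|apply: (ru 3)].
  - by split; [apply: (rd 2)|apply: (rd 3)].
  - by split; apply: y01.
  - exact: u01.
  - exact: u01.
  - exact: (uy 2).
  - exact: (uy 3).
move=> [[[x1 x2 x3] [/andP xb1 /andP xb2 /andP xb3] [ru2 ru3] [rd2 rd3]]
  [[y1 y2 y3] u2 u3 uy2 uy3] up down].
do 8?[split; first by case=> [|[|[|[|t]]]] // _; rewrite ?sum23];
  by case=> [|[|[|[|t]]]] // _.
Qed.

Lemma Pset_min1 p : Pset 3 1 1 Cl Cu Vb V p <->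
  [/\ ramping p, commitment p, u_ p 2 <= y_ p 2 /\ u_ p 3 <= y_ p 3
    & u_ p 2 <= 1 - y_ p 1 /\ u_ p 3 <= 1 - y_ p 2].
Proof.
have sum2 : \sum_(2 - 1 + 1 <= i < 3) u_ p i = u_ p 2.
  by rewrite big_nat1.
have sum3 : \sum_(3 - 1 + 1 <= i < 4) u_ p i = u_ p 3.
  by rewrite big_nat1.
split.
  move=> [x0 [y01 [u01 [up [down [uy [xb [ru rd]]]]]]]].
  have := up 2 isT; have := down 2 isT; rewrite sum2 => d2 u2.
  have := up 3 isT; have := down 3 isT; rewrite sum3 => d3 u3.
  have [[b1 b2] b3] := (xb 1 isT, xb 2 isT, xb 3 isT).
  split; last (by split; [exact: d2|exact: d3]);
    last (by split; [exact: u2|exact: u3]); split.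
  - by split; apply: x0.
  - by split; apply/andP.
  - by split; [apply: (ru 2)|apply: (ru 3)].
  - by split; [apply: (rd 2)|apply: (rd 3)].
  - by split; apply: y01.
  - exact: u01.
  - exact: u01.
  - exact: (uy 2).
  - exact: (uy 3).
move=> [[[x1 x2 x3] [/andP xb1 /andP xb2 /andP xb3] [ru2 ru3] [rd2 rd3]]
  [[y1 y2 y3] u2 u3 uy2 uy3] [up2 up3] [down2 down3]].
do 8?[split; first by case=> [|[|[|[|t]]]] // _;
  rewrite ?sum2 ?sum3];
  by case=> [|[|[|[|t]]]] // _.
Qed.

End Pset3.

(** * Convex combinations with prescribed masses *)

Section cone_pt.
Variables (R : realType) (Cl Cu Vb V : R).

Definition admits (S : set (ucpoint R 3)) (y1 y2 y3 u2 u3 : R) :=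
  forall z1 z2 z3, ramping Cl Cu Vb V (pt z1 z2 z3 y1 y2 y3 u2 u3) ->
    S (pt z1 z2 z3 y1 y2 y3 u2 u3).

(** Only the pattern is multiplied by the mass [lam]: the outputs are parts as in [splits], already
    scaled. *)
Definition cone_at (S : set (ucpoint R 3)) (lam x1 x2 x3 y1 y2 y3 u2 u3 : R) :=
  cone S lam
    (pt x1 x2 x3 (lam * y1) (lam * y2) (lam * y3) (lam * u2) (lam * u3)).

(** For positive mass, dividing by [lam] gives a point of the pattern. For mass 0 the bounds force
    zero outputs and the all-off point is the witness, so the pattern itself need not be allowed. *)
Lemma cone_pt (S : set (ucpoint R 3)) (lam x1 x2 x3 y1 y2 y3 u2 u3 : R) :
  0 <= lam -> admits S 0 0 0 0 0 -> (0 < lam -> admits S y1 y2 y3 u2 u3) ->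
  [/\ 0 <= x1, 0 <= x2 & 0 <= x3] ->
  [/\ lam * (Cl * y1) <= x1 <= lam * (Cu * y1),
      lam * (Cl * y2) <= x2 <= lam * (Cu * y2)
    & lam * (Cl * y3) <= x3 <= lam * (Cu * y3)] ->
  [/\ x2 - x1 <= lam * (V * y1 + Vb * (1 - y1)),
      x3 - x2 <= lam * (V * y2 + Vb * (1 - y2)),
      x1 - x2 <= lam * (V * y2 + Vb * (1 - y2))
    & x2 - x3 <= lam * (V * y3 + Vb * (1 - y3))] ->
  0 <= Vb ->
  cone_at S lam x1 x2 x3 y1 y2 y3 u2 u3.
Proof.
move=> lam0 S0 Sy [x10 x20 x30] [b1 b2 b3] [r2 r3 d2 d3] Vb0.
move: lam0; rewrite le_eqVlt => /orP[/eqP lam0|lam0].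
  exists (pt 0 0 0 0 0 0 0 0).
    by apply: S0; rewrite /ramping !ptE; do !split; rewrite ?mulr0; lra.
  rewrite -lam0 !mul0r in b1 b2 b3 *.
  by apply: ucpoint_eq; rewrite !ucpointE !ptE; lra.
have div x : exists z, x = lam * z by exists (x / lam); rewrite mulrC divfK ?gt_eqF.
have [z1 e1] := div x1; have [z2 e2] := div x2; have [z3 e3] := div x3.
rewrite {}e1 {}e2 {}e3 -?mulrBr ?(ler_pM2l lam0)
  in x10 x20 x30 b1 b2 b3 r2 r3 d2 d3 *.
rewrite !pmulr_rge0 // in x10 x20 x30.
exists (pt z1 z2 z3 y1 y2 y3 u2 u3).
  by apply: Sy => //; rewrite /ramping !ptE.
by apply: ucpoint_eq; rewrite !ucpointE !ptE.
Qed.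

End cone_pt.

(** The free masses are [e] for 010 and [f] for 101. The others follow from [y] and [u]: [a - f] for
    100, [u3 - f] for 001, [s1], [s2], [s3] for 110, 011, 111, and the remainder for 000. *)
Lemma assemble (R : realType) (Cl Cu Vb V : R) (S : set (ucpoint R 3)) p (e f : R) :
  0 <= Cl -> Cl + V <= Vb -> Vb <= Cu -> 0 < V -> Cu <= Vb + V ->
  convex_set S ->
  admits Cl Cu Vb V S 0 0 0 0 0 -> admits Cl Cu Vb V S 0 0 1 0 1 ->
  admits Cl Cu Vb V S 0 1 1 1 0 -> admits Cl Cu Vb V S 1 0 0 0 0 ->
  admits Cl Cu Vb V S 1 1 0 0 0 -> admits Cl Cu Vb V S 1 1 1 0 0 ->
  (0 < e -> admits Cl Cu Vb V S 0 1 0 1 0) ->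
  (0 < f -> admits Cl Cu Vb V S 1 0 1 0 1) ->
  let x1 := x_ p 1 in let x2 := x_ p 2 in let x3 := x_ p 3 in
  let y1 := y_ p 1 in let y2 := y_ p 2 in let y3 := y_ p 3 in
  let u2 := u_ p 2 in let u3 := u_ p 3 in
  [/\ 0 <= f, f <= y1 - y2 + u2, f <= u3 & 0 <= 1 - y1 - u2 - u3 + f] ->
  [/\ Cl * y1 <= x1, Cl * y2 <= x2 & Cl * y3 <= x3] ->
  x1 <= Vb * y1 + (Cu - Vb) * (y2 - u2) ->
  x3 <= Cu * y3 - (Cu - Vb) * u3 ->
  x2 - x1 <= (Cl + V) * y2 - Cl * y1 - (Cl + V - Vb) * u2 ->
  x3 - x2 <= (Cl + V) * y3 - Cl * y2 - (Cl + V - Vb) * u3 ->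
  x1 - x2 <= Vb * y1 - (Vb - V) * y2 - (Cl + V - Vb) * u2 ->
  x2 - x3 <= Vb * y2 - (Vb - V) * y3 - (Cl + V - Vb) * u3 ->
  mass010_ok (x1 - Cl * y1) (x2 - Cl * y2) (x3 - Cl * y3)
    ((Vb - Cl) * (y1 - y2 + u2)) ((Vb - Cl) * u3) u2 (y2 - y3 + u3) y2
    V (Vb - Cl) (Cu - Cl) e ->
  S p.
Proof.
move=> hCl h1 hVbCu hV h3 cS S000 S001 S011 S100 S110 S111 S010 S101.
move=> x1 x2 x3 y1 y2 y3 u2 u3 [f0 fa fc f000] [xl1 xl2 xl3] xu1 xu3 r2 r3 d2 d3.
move=> [e0 s10 s20 s30 [hx2 hs hl f1 f2]].
set a := y1 - y2 + u2 in fa hs f1 f2 *.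
set s1 := y2 - y3 + u3 - e in s10 hx2 hs hl f1 f2.
set s2 := u2 - e in s20 hx2 hs hl f1 f2.
set s3 := y2 - u2 - (y2 - y3 + u3) + e in s30 hx2 hs hl f1 f2.
have pV0 m : 0 <= m -> 0 <= V * m by move=> m0; rewrite mulr_ge0 // ltW.
have pVB m : 0 <= m -> V * m <= (Vb - Cl) * m
  by move=> m0; rewrite ler_wpM2r //; clear - h1 hVbCu h3; lra.
have pBD m : 0 <= m -> (Vb - Cl) * m <= (Cu - Cl) * m
  by move=> m0; rewrite ler_wpM2r //; clear - h1 hVbCu h3; lra.
have pDB m : 0 <= m -> (Cu - Cl) * m <= (Vb - Cl) * m + V * m.
  by move=> m0; rewrite -mulrDl ler_wpM2r //; lra.
have pB0 m : 0 <= m -> 0 <= (Vb - Cl) * m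
  by move=> m0; rewrite mulr_ge0 //; clear - h1 hCl hV; lra.
have pC0 m : 0 <= m -> 0 <= Cl * m
  by move=> m0; rewrite mulr_ge0 //; clear - h1 hCl hV; lra.
have a0 : 0 <= a := le_trans f0 fa.
have c0 : 0 <= u3 := le_trans f0 fc.
have X1u : x1 - Cl * y1 <= (Vb - Cl) * a + (Cu - Cl) * s1 + (Cu - Cl) * s3.
  by clear - xu1; rewrite /a /s1 /s3; lra.
have X3u : x3 - Cl * y3 <= (Vb - Cl) * u3 + (Cu - Cl) * s2 + (Cu - Cl) * s3.
  by clear - xu3; rewrite /s2 /s3; lra.
have g21 : x2 - Cl * y2 - (x1 - Cl * y1) <=
    (Vb - Cl) * e + V * s1 + (Vb - Cl) * s2 + V * s3.
  by clear - r2; rewrite /s1 /s2 /s3; lra.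
have g23 : x2 - Cl * y2 - (x3 - Cl * y3) <=
    (Vb - Cl) * e + (Vb - Cl) * s1 + V * s2 + V * s3.
  by clear - d3; rewrite /s1 /s2 /s3; lra.
have g32 : x3 - Cl * y3 - (x2 - Cl * y2) <= (Vb - Cl) * u3 + V * s2 + V * s3.
  by clear - r3; rewrite /s2 /s3; lra.
have g12 : x1 - Cl * y1 - (x2 - Cl * y2) <= (Vb - Cl) * a + V * s1 + V * s3.
  by clear - d2; rewrite /a /s1 /s3; lra.
have X10 : 0 <= x1 - Cl * y1 by rewrite subr_ge0.
have X20 : 0 <= x2 - Cl * y2 by rewrite subr_ge0.
have X30 : 0 <= x3 - Cl * y3 by rewrite subr_ge0.
have par : pattern_params ((Vb - Cl) * a) ((Vb - Cl) * u3) ((Vb - Cl) * e)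
    (V * s1) ((Vb - Cl) * s1) ((Cu - Cl) * s1)
    (V * s2) ((Vb - Cl) * s2) ((Cu - Cl) * s2) (V * s3) ((Cu - Cl) * s3).
  split; split; auto; exact: le_trans (pVB _ s30) (pBD _ s30).
have [|z1 [p1 [r1 [w [p2 [q2 [t2 [q3 [t3 [z3
    [E1 E2 E3 Hw [H110 H011 H111]]]]]]]]]]]] :=
  @facets_split _ (x1 - Cl * y1) (x2 - Cl * y2) (x3 - Cl * y3)
    _ _ _ _ _ _ _ _ _ _ _ par.
  by split.
clear r2 r3 d2 d3 xu1 xu3 hx2 hs hl f1 f2 X1u X3u X10 X20 X30 xl1 xl2
  xl3 g21 g23 g32 g12 par.
(* Both 100 and 101 are off in period 2, so up to here they were merged with mass [a]; their
   period-1 output is now shared out. The same is done for 001 and 101 in period 3. *)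
have [za [zf [Eaf Ha Hf]]] : exists za zf, [/\ za + zf = z1,
    0 <= za <= (Vb - Cl) * (a - f) & 0 <= zf <= (Vb - Cl) * f].
  have k := pB0 _ f0; have k' : 0 <= a - f by rewrite subr_ge0.
  have {}k' := pB0 _ k'.
  apply: split2 => //; clear - Hw; lra.
have [zc [zg [Ecg Hc Hg]]] : exists zc zg, [/\ zc + zg = z3,
    0 <= zc <= (Vb - Cl) * (u3 - f) & 0 <= zg <= (Vb - Cl) * f].
  have k := pB0 _ f0; have k' : 0 <= u3 - f by rewrite subr_ge0.
  have {}k' := pB0 _ k'.
  apply: split2 => //; clear - Hw; lra.
have Vb0 : 0 <= Vb by clear - hCl h1 hV; lra.
have af : 0 <= a - f by rewrite subr_ge0.
have cf : 0 <= u3 - f by rewrite subr_ge0.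
have n0 : 0 <= 1 - y1 - u2 - u3 + f by [].
have w0 : 0 <= w <= (Vb - Cl) * e by clear - Hw; lra.
have VbM m : 0 <= m -> 0 <= Vb * m by move=> m0; rewrite mulr_ge0.
have pAll m : 0 <= m ->
  [/\ 0 <= V * m, (Vb - Cl) * m <= (Cu - Cl) * m, 0 <= (Vb - Cl) * m,
    0 <= Cl * m & 0 <= Vb * m].
  by move=> m0; split; auto.
clear pV0 pVB pBD pDB pB0 pC0 VbM.
have k000 : cone_at S (1 - y1 - u2 - u3 + f) 0 0 0 0 0 0 0 0.
  have := pAll _ n0; clear - S000 n0 Vb0 => -[? ? ? ? ?].
  by apply: (@cone_pt _ Cl Cu Vb V) => //; do !split; lra.
have k100 : cone_at S (a - f) (Cl * (a - f) + za) 0 0 1 0 0 0 0.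
  have := pAll _ af; clear - S000 S100 Ha af Vb0 => -[? ? ? ? ?].
  by apply: (@cone_pt _ Cl Cu Vb V) => //; do !split; lra.
have k001 : cone_at S (u3 - f) 0 0 (Cl * (u3 - f) + zc) 0 0 1 0 1.
  have := pAll _ cf; clear - S000 S001 Hc cf Vb0 => -[? ? ? ? ?].
  by apply: (@cone_pt _ Cl Cu Vb V) => //; do !split; lra.
have k101 : cone_at S f (Cl * f + zf) 0 (Cl * f + zg) 1 0 1 0 1.
  have := pAll _ f0; clear - S000 S101 Hf Hg f0 Vb0 => -[? ? ? ? ?].
  by apply: (@cone_pt _ Cl Cu Vb V) => //; do !split; lra.
have k010 : cone_at S e 0 (Cl * e + w) 0 0 1 0 1 0.
  have := pAll _ e0; clear - S000 S010 w0 e0 Vb0 => -[? ? ? ? ?].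
  by apply: (@cone_pt _ Cl Cu Vb V) => //; do !split; lra.
have k110 : cone_at S s1 (Cl * s1 + p1) (Cl * s1 + p2) 0 1 1 0 0 0.
  have := pAll _ s10; clear - S000 S110 H110 s10 Vb0 => -[? ? ? ? ?].
  by apply: (@cone_pt _ Cl Cu Vb V) => //; do !split; lra.
have k011 : cone_at S s2 0 (Cl * s2 + q2) (Cl * s2 + q3) 0 1 1 1 0.
  have := pAll _ s20; clear - S000 S011 H011 s20 Vb0 => -[? ? ? ? ?].
  by apply: (@cone_pt _ Cl Cu Vb V) => //; do !split; lra.
have k111 : cone_at S s3 (Cl * s3 + r1) (Cl * s3 + t2) (Cl * s3 + t3) 1 1 1 0 0.
  have := pAll _ s30; clear - S000 S111 H111 s30 Vb0 => -[? ? ? ? ?].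
  by apply: (@cone_pt _ Cl Cu Vb V) => //; do !split; lra.
(* The eight masses sum to 1, so adding up the cones lands at height 1, that is, in [S] itself. *)
have sum1 : 1 - y1 - u2 - u3 + f +
    (a - f + (u3 - f + (f + (e + (s1 + (s2 + s3)))))) = 1.
  by clear; rewrite /a /s1 /s2 /s3; lra.
have m0 := addr_ge0 s20 s30; have j0 := coneD cS s20 s30 k011 k111.
have m1 := addr_ge0 s10 m0; have j1 := coneD cS s10 m0 k110 j0.
have m2 := addr_ge0 e0 m1; have j2 := coneD cS e0 m1 k010 j1.
have m3 := addr_ge0 f0 m2; have j3 := coneD cS f0 m2 k101 j2.
have m4 := addr_ge0 cf m3; have j4 := coneD cS cf m3 k001 j3.
have m5 := addr_ge0 af m4; have j5 := coneD cS af m4 k100 j4.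
have m6 := addr_ge0 n0 m5; have j6 := coneD cS n0 m5 k000 j5.
move: j6; rewrite sum1 => -[].
move=> q Sq; rewrite scale1r => Eq; suff -> : p = q by [].
rewrite -Eq !ptD; clear - Eaf Ecg E1 E2 E3.
apply: ucpoint_eq.
- rewrite ptE -/x1; by rewrite /a /s1 /s3 in E1 *; lra.
- rewrite ptE -/x2; by rewrite /s1 /s2 /s3 in E2 *; lra.
- rewrite ptE -/x3; by rewrite /s2 /s3 in E3 *; lra.
- rewrite ptE -/y1; by rewrite /a /s1 /s3; lra.
- rewrite ptE -/y2; by rewrite /s1 /s2 /s3; lra.
- rewrite ptE -/y3; by rewrite /s2 /s3; lra.
- rewrite ptE -/u2; by rewrite /s2; lra.
- rewrite ptE -/u3; by lra.
Qed.

(** * Validity of the inequalities *)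

Lemma conv_hullW (R : realType) (E : lmodType R) (S C : set E) :
  S `<=` C -> convex_set C -> conv_hull S `<=` C.
Proof. by move=> SC cC; exact: (smallest_sub cC SC). Qed.

Lemma conv_hull_convex (R : realType) (E : lmodType R) (S : set E) :
  convex_set (conv_hull S).
Proof.
move=> p q t /set_mem hp /set_mem hq; apply/mem_set => C [cC SC].
have hCp := hp C (conj cC SC); have hCq := hq C (conj cC SC).
by apply/set_mem; apply: cC; apply/mem_set.
Qed.

Lemma convex_setP (R : realType) (E : lmodType R) (S : set E) :
  (forall p q t, 0 <= t <= 1 -> S p -> S q -> S (t *: p + (1 - t) *: q)) ->
  convex_set S.
Proof.
move=> h p q t /set_mem Sp /set_mem Sq; apply/mem_set/h => //.
by apply/andP; split.
Qed.

Lemma le_conv (R : realType) (t a b c d : R) : 0 <= t <= 1 ->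
  a <= b -> c <= d -> t * a + (1 - t) * c <= t * b + (1 - t) * d.
Proof. by move=> ht ab cd; rewrite lerD // ler_wpM2l //; lra. Qed.

Lemma setI_convex (R : realType) (E : lmodType R) (S T : set E) :
  convex_set S -> convex_set T -> convex_set (S `&` T).
Proof.
move=> cS cT p q t /set_mem[Sp Tp] /set_mem[Sq Tq]; apply/mem_set; split.
  by apply/set_mem; apply: cS; apply/mem_set.
by apply/set_mem; apply: cT; apply/mem_set.
Qed.

Section convex.
Variables (R : realType) (Cl Cu Vb V : R).

Lemma F1_convex : convex_set (F1 Cl Cu Vb V).
Proof.
apply: convex_setP => p q t ht; rewrite /F1 /= !ucpointE => h k.
by have := le_conv ht h k; clear; lra.
Qed.

Lemma F2_convex : convex_set (F2 Cl Cu Vb V).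
Proof.
apply: convex_setP => p q t ht; rewrite /F2 /= !ucpointE => h k.
by have := le_conv ht h k; clear; lra.
Qed.

Lemma Aset_convex : convex_set (Aset Cl Cu Vb V).
Proof.
apply: convex_setP => p q t ht; rewrite /Aset /= !ucpointE.
do 17![move=> [h hs] [k ks]; split;
  first (by have := le_conv ht h k; clear; lra); move: hs ks; clear h k].
by move=> h k; have := le_conv ht h k; clear; lra.
Qed.

Lemma Bset_convex : convex_set (Bset Cl Cu Vb V).
Proof.
apply: convex_setP => p q t ht; rewrite /Bset /= !ucpointE.
do 18![move=> [h hs] [k ks]; split;
  first (by have := le_conv ht h k; clear; lra); move: hs ks; clear h k].
by move=> h k; have := le_conv ht h k; clear; lra.
Qed.

End convex.

Section incl.
Variables (R : realType) (Cl Cu Vb V : R).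
Implicit Types p : ucpoint R 3.

(** From [u_2 + u_3 <= y_3 <= y_2 + u_3] one gets [u_2 <= y_2], and from [y_2 - y_1 <= u_2] with the
    down-time constraint [u_3 <= 1 - y_2]. Validity results for time 1 thus carry over to time 2. *)
Lemma Pset_min2_sub_min1 : Pset 3 2 2 Cl Cu Vb V `<=` Pset 3 1 1 Cl Cu Vb V.
Proof.
move=> p /Pset_min2[hr hc up down]; apply/Pset_min1; split=> //.
all: case: hc => _ u2 u3 c2 c3.
all: have u2_ge0 : 0 <= u_ p 2 by case: u2 => ->.
all: have u3_ge0 : 0 <= u_ p 3 by case: u3 => ->.
all: by clear - up down c2 c3 u2_ge0 u3_ge0; split; lra.
Qed.

(** The constraints pin [u] to the off-to-on transitions, so only the eight patterns of [y] remain
    to be checked. *)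
Lemma Pset_min1_start p : Pset 3 1 1 Cl Cu Vb V p ->
  u_ p 2 = (1 - y_ p 1) * y_ p 2 /\ u_ p 3 = (1 - y_ p 2) * y_ p 3.
Proof.
move=> /Pset_min1[_ [[y1 y2 y3] u2 u3 c2 c3] [up2 up3] [down2 down3]].
by split; [case: y1 y2 u2 c2 up2 down2 => -> [] -> [] -> *; lra
  |case: y2 y3 u3 c3 up3 down3 => -> [] -> [] -> *; lra].
Qed.

Hypotheses (hCl : 0 <= Cl) (hVbCu : Vb <= Cu) (hV : 0 < V)
    (h1 : Cl + V <= Vb) (h3 : Cu <= Vb + V).

(** Applied to periods 1, 2 and to periods 2, 3, this covers every inequality of [Bset]; four on/off
    pairs are checked. *)
Lemma two_period (x y x' y' u : R) :
  y = 0 \/ y = 1 -> y' = 0 \/ y' = 1 -> u = (1 - y) * y' ->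
  Cl * y <= x <= Cu * y -> Cl * y' <= x' <= Cu * y' ->
  x' - x <= V * y + Vb * (1 - y) -> x - x' <= V * y' + Vb * (1 - y') ->
  [/\ [/\ y' - y <= u, 0 <= u, u <= y' & y + u <= 1],
    x <= Vb * y + (Cu - Vb) * (y' - u), x' <= Cu * y' - (Cu - Vb) * u,
    x' - x <= (Cl + V) * y' - Cl * y - (Cl + V - Vb) * u &
    x - x' <= Vb * y - (Vb - V) * y' - (Cl + V - Vb) * u].
Proof.
move: (hCl) (hVbCu) (hV) (h1) => ? ? ? ? [] -> [] -> -> b b' r d.
all: rewrite ?(mulr0, mulr1, subr0, subrr, addr0, add0r, mul0r, mul1r) in b b' r d *.
all: by split; first split; lra.
Qed.

Lemma Pset_sub_B : Pset 3 1 1 Cl Cu Vb V `<=` Bset Cl Cu Vb V.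
Proof.
move=> p Pp; have [eu2 eu3] := Pset_min1_start Pp.
move: Pp => /Pset_min1[[_ [b1 b2 b3] [r2 r3] [d2 d3]] [[y1 y2 y3] _ _ _ _] _ _].
have [[s12 s12' s12'' s12'''] ub1 ub2 ru2 rd2] := two_period y1 y2 eu2 b1 b2 r2 d2.
have [[s23 s23' s23'' s23'''] ub2' ub3 ru3 rd3] := two_period y2 y3 eu3 b2 b3 r3 d3.
by move: b1 b2 b3 => /andP[? _] /andP[? _] /andP[? _].
Qed.

Lemma Pset_sub_F : Cu - Cl - 2 * V >= 0 ->
  Pset 3 1 1 Cl Cu Vb V `<=` F1 Cl Cu Vb V `&` F2 Cl Cu Vb V.
Proof.
move=> h4 p Pp; have [eu2 eu3] := Pset_min1_start Pp.
move: Pp => /Pset_min1[[_ [b1 b2 b3] [r2 r3] [d2 d3]] [[y1 y2 y3] _ _ _ _] _ _].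
rewrite /F1 /F2 /setI /= {}eu2 {}eu3.
move: (hCl) (hVbCu) (hV) (h1) (h3) => ? ? ? ? ?.
by case: y1 b1 r2 => -> b1 r2; case: y2 b2 r3 d2 => -> b2 r3 d2;
  case: y3 b3 d3 => -> b3 d3; split; lra.
Qed.

Lemma Pset_sub_A : Pset 3 2 2 Cl Cu Vb V `<=` Aset Cl Cu Vb V.
Proof.
move=> p Pp; have Pp1 := Pset_min2_sub_min1 Pp.
have [eu2 eu3] := Pset_min1_start Pp1.
have [v1 [v2 [v3 [v4 [v5 [v6 [v7 v8]]]]]]] := Pset_sub_B Pp1.
have [v9 [v10 [v11 [v12 [v13 [v14 v15]]]]]] := v8.
have [v16 [v17 [v18 [v19 [v20 v21]]]]] := v15.
move: Pp => /Pset_min2[[_ [b1 b2 b3] [r2 r3] [d2 d3]] [[y1 y2 y3] _ _ _ _] up down].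
(* Besides [up], these are the inequalities of [Aset] absent from [Bset]; they are checked pattern
   by pattern, [up] and [down] excluding 010 and 101. *)
have [w1 w2 w3 w4] : [/\ y_ p 1 + u_ p 2 + u_ p 3 <= 1,
  x_ p 2 <= Vb * y_ p 2 + (Cu - Vb) * (y_ p 3 - u_ p 3 - u_ p 2),
  x_ p 1 - x_ p 2 + x_ p 3 <= Vb * y_ p 1 - (Vb - V) * y_ p 2 + Vb * y_ p 3
                        + (Cu - Vb) * (y_ p 3 - u_ p 3 - u_ p 2) &
  Cl * y_ p 1 - (Cl + V) * y_ p 2 + Cl * y_ p 3 <= x_ p 1 - x_ p 2 + x_ p 3].
  clear - hCl hVbCu hV h1 h3 eu2 eu3 b1 b2 b3 r2 r3 d2 d3 y1 y2 y3 up down.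
  rewrite {}eu2 {}eu3 in up down *.
  move: (hCl) (hVbCu) (hV) (h1) (h3) => ? ? ? ? ?.
  by case: y1 b1 r2 up down => -> b1 r2 up down;
    case: y2 b2 r3 d2 up down => -> b2 r3 d2 up down;
    case: y3 b3 d3 up down => -> b3 d3 up down; split; lra.
by [].
Qed.

End incl.

(** * Sufficiency of the inequalities *)

Section hull.
Variables (R : realType) (Cl Cu Vb V : R).

(** Boolean patterns turn the commitment constraints into comparisons of natural numbers, decided by
    computation for each concrete pattern. *)
Lemma bool_commitment (x1 x2 x3 : R) (b1 b2 b3 c2 c3 : bool) :
  (b2 <= b1 + c2)%N -> (b3 <= b2 + c3)%N ->
  commitment (pt x1 x2 x3 b1%:R b2%:R b3%:R c2%:R c3%:R).
Proof.
have b01 (b : bool) : b%:R = 0 :> R \/ b%:R = 1 :> R by case: b; [right|left].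
move=> le2 le3; rewrite /commitment !ptE; split=> //.
- by rewrite -addrA -opprD subr_le0 -natrD ler_nat.
- by rewrite -addrA -opprD subr_le0 -natrD ler_nat.
Qed.

Lemma admits_min2 (b1 b2 b3 c2 c3 : bool) :
  (b2 <= b1 + c2)%N -> (b3 <= b2 + c3)%N -> (c2 + c3 <= b3)%N ->
  (c2 + c3 + b1 <= 1)%N ->
  admits Cl Cu Vb V (conv_hull (Pset 3 2 2 Cl Cu Vb V))
    b1%:R b2%:R b3%:R c2%:R c3%:R.
Proof.
move=> le2 le3 up down x1 x2 x3 hr; apply: sub_gen_smallest; apply/Pset_min2.
split; [by []|exact: bool_commitment| |]; rewrite !ptE.
- by rewrite -natrD ler_nat.
- by rewrite lerBrDr -!natrD (ler_nat _ _ 1).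
Qed.

Lemma admits_min1 (b1 b2 b3 c2 c3 : bool) :
  (b2 <= b1 + c2)%N -> (b3 <= b2 + c3)%N -> (c2 <= b2)%N -> (c3 <= b3)%N ->
  (c2 + b1 <= 1)%N -> (c3 + b2 <= 1)%N ->
  admits Cl Cu Vb V (conv_hull (Pset 3 1 1 Cl Cu Vb V))
    b1%:R b2%:R b3%:R c2%:R c3%:R.
Proof.
move=> le2 le3 u2 u3 d2 d3 x1 x2 x3 hr; apply: sub_gen_smallest; apply/Pset_min1.
split; [by []|exact: bool_commitment| |]; rewrite !ptE.
- by rewrite !ler_nat.
- by rewrite !lerBrDr -!natrD !(ler_nat _ _ 1).
Qed.

End hull.

Lemma A_sub_hull (R : realType) (Cl Cu Vb V : R) p :
  0 <= Cl -> Vb <= Cu -> 0 < V -> Cl + V <= Vb -> Cu <= Vb + V ->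
  Aset Cl Cu Vb V p ->
  Cu - Cl - 2 * V < 0 \/ F1 Cl Cu Vb V p /\ F2 Cl Cu Vb V p ->
  conv_hull (Pset 3 2 2 Cl Cu Vb V) p.
Proof.
move=> hCl hVbCu hV h1 h3.
rewrite /Aset /F1 /F2 /= => -[a1 [a2 [a3 [a4 [a5 [a6 [a7 [a8 [a9]]]]]]]]].
move=> [a10 [a11 [a12 [a13 [a14 [a15 [a16 [a17 a18]]]]]]]] hF.
(* With times 2, pattern 010 violates the minimum-up time and 101 the minimum-down time, so both get
   mass 0. *)
apply: (assemble (e := 0) (f := 0) hCl h1 hVbCu hV h3 (@conv_hull_convex _ _ _));
  try by rewrite ltxx.
- exact: (@admits_min2 _ _ _ _ _ false false false false false).
- exact: (@admits_min2 _ _ _ _ _ false false true false true).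
- exact: (@admits_min2 _ _ _ _ _ false true true true false).
- exact: (@admits_min2 _ _ _ _ _ true false false false false).
- exact: (@admits_min2 _ _ _ _ _ true true false false false).
- exact: (@admits_min2 _ _ _ _ _ true true true false false).
- by clear - a2 a3 a6; split; lra.
- by split.
- exact: a10.
- exact: a12.
- exact: a13.
- exact: a14.
- exact: a15.
- exact: a16.
have s3 : 0 <= y_ p 3 - u_ p 2 - u_ p 3 by clear - a1; lra.
split; [by []|by clear - a4; lra|by clear -a5; lra|by clear - a1; lra|split].
- by clear - a11; lra.
- by clear - a17; lra.
- by clear - a18; lra.
(* In the short range, (F1) follows from the upper bound on [x_3] and the lower bound on [x_1],
   since [Cu - Cl] is below [2 * V] on the mass of 111; (F2) is symmetric. *)
- case: hF => [h4|[]]; last by clear; lra.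
  have := mulr_ge0 (_ : 0 <= 2 * V - (Cu - Cl)) s3.
  by clear - a12 a7 h4; lra.
- case: hF => [h4|[]]; last by clear; lra.
  have := mulr_ge0 (_ : 0 <= 2 * V - (Cu - Cl)) s3.
  by clear - a10 a9 h4; lra.
Qed.

Lemma B_sub_hull (R : realType) (Cl Cu Vb V : R) p :
  0 <= Cl -> Vb <= Cu -> 0 < V -> Cl + V <= Vb -> Cu <= Vb + V ->
  Bset Cl Cu Vb V p ->
  Cu - Cl - 2 * V < 0 \/
  0 <= Cu - Cl - 2 * V /\ F1 Cl Cu Vb V p /\ F2 Cl Cu Vb V p ->
  conv_hull (Pset 3 1 1 Cl Cu Vb V) p.
Proof.
move=> hCl hVbCu hV h1 h3.
rewrite /Bset /F1 /F2 /= => -[b1 [b2 [b3 [b4 [b5 [b6 [b7 [b8 [b9]]]]]]]]].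
move=> [b10 [b11 [b12 [b13 [b14 [b15 [b16 [b17 [b18 b19]]]]]]]]] hF.
have B0 : 0 <= Vb - Cl by clear - h1 hV; lra.
have a0 : 0 <= (Vb - Cl) * (y_ p 1 - y_ p 2 + u_ p 2).
  by apply: mulr_ge0 => //; clear - b1; lra.
have c0 : 0 <= (Vb - Cl) * u_ p 3 by exact: mulr_ge0.
have be0 : 0 <= y_ p 2 - y_ p 3 + u_ p 3 by clear - b2; lra.
have beY : y_ p 2 - y_ p 3 + u_ p 3 <= y_ p 2 by clear - b9; lra.
have VB : V <= Vb - Cl by clear - h1; lra.
have BD : Vb - Cl <= Cu - Cl by clear - hVbCu; lra.
have DB : Cu - Cl <= Vb - Cl + V by clear - h3; lra.
have X1 : 0 <= x_ p 1 - Cl * y_ p 1 by rewrite subr_ge0.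
have X2 : 0 <= x_ p 2 - Cl * y_ p 2 by rewrite subr_ge0.
have X3 : 0 <= x_ p 3 - Cl * y_ p 3 by rewrite subr_ge0.
have [e he] : exists e, mass010_ok (x_ p 1 - Cl * y_ p 1) (x_ p 2 - Cl * y_ p 2)
  (x_ p 3 - Cl * y_ p 3) ((Vb - Cl) * (y_ p 1 - y_ p 2 + u_ p 2))
  ((Vb - Cl) * u_ p 3) (u_ p 2) (y_ p 2 - y_ p 3 + u_ p 3) (y_ p 2)
  V (Vb - Cl) (Cu - Cl) e.
  case: hF => [h4|[h4 [hF1 hF2]]].
    apply: mass010_ex_short => //.
    - by clear - h4; lra.
    - by clear - b12; lra.
    - by clear - b15; lra.
    - by clear - b13; lra.
    - by clear - b14; lra.
    - by clear - b16; lra.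
    - by clear - b19; lra.
    - by clear - b17; lra.
    - by clear - b18; lra.
  apply: mass010_ex_long => //.
  - by clear - h4; lra.
  - by clear - b12; lra.
  - by clear - b15; lra.
  - by clear - b13; lra.
  - by clear - b14; lra.
  - by clear - b16; lra.
  - by clear - b19; lra.
  - by clear - b17; lra.
  - by clear - b18; lra.
  - by clear - hF1; lra.
  - by clear - hF2; lra.
(* This [f] is the smallest mass of 101 that keeps the mass of 000 nonnegative. *)
apply: (assemble (e := e) (f := Num.max 0 (y_ p 1 + u_ p 2 + u_ p 3 - 1))
  hCl h1 hVbCu hV h3 (@conv_hull_convex _ _ _)).
- exact: (@admits_min1 _ _ _ _ _ false false false false false).
- exact: (@admits_min1 _ _ _ _ _ false false true false true).
- exact: (@admits_min1 _ _ _ _ _ false true true true false).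
- exact: (@admits_min1 _ _ _ _ _ true false false false false).
- exact: (@admits_min1 _ _ _ _ _ true true false false false).
- exact: (@admits_min1 _ _ _ _ _ true true true false false).
- by move=> _; exact: (@admits_min1 _ _ _ _ _ false true false true false).
- by move=> _; exact: (@admits_min1 _ _ _ _ _ true false true false true).
- by clear - b1 b4 b10 b11; rewrite le_max !ge_max lexx; case: leP => ?; split; lra.
- by [].
- exact: b12.
- exact: b15.
- exact: b16.
- exact: b17.
- exact: b18.
- exact: b19.
- exact: he.
Qed.

(** * The convex hulls for both minimum times *)

Theorem theorem9 (R : realType) (Cl Cu Vb V : R)
    (hCl : 0 <= Cl) (hClVb : Cl <= Vb) (hVbCu : Vb <= Cu) (hV : 0 < V)
    (h1 : Vb >= Cl + V) (h2 : Cu - Cl - V >= 0) (h3 : Cu - Vb - V < 0) :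
  (Cu - Cl - 2 * V >= 0 ->
     conv_hull (Pset 3 2 2 Cl Cu Vb V)
       = Aset Cl Cu Vb V `&` F1 Cl Cu Vb V `&` F2 Cl Cu Vb V /\
     conv_hull (Pset 3 1 1 Cl Cu Vb V)
       = Bset Cl Cu Vb V `&` F1 Cl Cu Vb V `&` F2 Cl Cu Vb V) /\
  (Cu - Cl - 2 * V < 0 ->
     conv_hull (Pset 3 2 2 Cl Cu Vb V) = Aset Cl Cu Vb V /\
     conv_hull (Pset 3 1 1 Cl Cu Vb V) = Bset Cl Cu Vb V).
Proof.
have h3' : Cu <= Vb + V by clear - h3; lra.
have PA := Pset_sub_A hCl hVbCu hV h1 h3'.
have PB := Pset_sub_B hCl hVbCu hV h1.
have P21 := @Pset_min2_sub_min1 _ Cl Cu Vb V.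
have cF1 := @F1_convex _ Cl Cu Vb V.
have cF2 := @F2_convex _ Cl Cu Vb V.
have cA := @Aset_convex _ Cl Cu Vb V.
have cB := @Bset_convex _ Cl Cu Vb V.
split=> h4; split; apply/seteqP; split.
- have PF := Pset_sub_F hCl hVbCu hV h1 h3' h4.
  apply: conv_hullW; last by do 2?apply: setI_convex.
  by move=> p Pp; have [? ?] := PF _ (P21 _ Pp); split; first split; auto.
- by move=> p [[Ap ? ?]]; apply: A_sub_hull => //; right.
- have PF := Pset_sub_F hCl hVbCu hV h1 h3' h4.
  apply: conv_hullW; last by do 2?apply: setI_convex.
  by move=> p Pp; have [? ?] := PF _ Pp; split; first split; auto.
- by move=> p [[Bp ? ?]]; apply: B_sub_hull => //; right.
- exact: conv_hullW PA cA.
- by move=> p Ap; apply: A_sub_hull => //; left.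
- exact: conv_hullW PB cB.
- by move=> p Bp; apply: B_sub_hull => //; left.
Qed.
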